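(* Let $(\omega,\tau_1,\dots,\tau_p)$ be an almost cosymplectic structure of order $p$ on a $(2n+p)$-dimensional manifold $M$, and let $B=\omega+\sum_{k=1}^p\tau_k\otimes\tau_k$ be its associated non-degenerate 2-covariant tensor field. The bivector field $\Lambda=-(\mathsf\Lambda^2\widehat B^{-1})(\omega)$ defines a Poisson structure if, and only if, (i) $(\mathsf\Lambda^3\,{}^{t}\mathrm{pr}_{\mathcal H})(\mathrm d\omega)=0$; (ii) for every $k$, $(\mathsf\Lambda^2\,{}^{t}\mathrm{pr}_{\mathcal H})(\mathrm d\tau_k)=0$.
   Context: Manifolds are smooth and paracompact, and all objects are smooth. An almost cosymplectic structure of order $p$ on a $(2n+p)$-dimensional manifold $M$ is a tuple $(\omega,\tau_1,\dots,\tau_p)$ with $\omega\in\Omega^2(M)$ and $\tau_1,\dots,\tau_p\in\Omega^1(M)$ such that $\omega^n\wedge\tau_1\wedge\cdots\wedge\tau_p$ is nowhere vanishing and $\omega^{n+1}=0$. Then $B$ is non-degenerate, meaning that $\widehat B\colon \mathrm TM\to \mathrm T^*M$, $\widehat B(v)=B(v,\cdot)$, is an isomorphism, and $\mathrm TM=\mathcal H\oplus\mathcal V$ with $\mathcal H=\bigcap_k\operatorname{Ker}\tau_k$ and $\mathcal V=\operatorname{Ker}\omega$ (the kernel of $v\mapsto\omega(v,\cdot)$). Explicitly, $\Lambda(\alpha,\beta)=-\omega(\widehat B^{-1}(\alpha),\widehat B^{-1}(\beta))$. $\mathrm{pr}_{\mathcal H}$ is the projection onto $\mathcal H$ along $\mathcal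 V$, and $\big((\mathsf\Lambda^j\,{}^{t}\mathrm{pr}_{\mathcal H})(\gamma)\big)(X_1,\dots,X_j)=\gamma(\mathrm{pr}_{\mathcal H}X_1,\dots,\mathrm{pr}_{\mathcal H}X_j)$. $\Lambda$ defines a Poisson structure if $[\Lambda,\Lambda]=0$ for the Schouten–Nijenhuis bracket. *)

(* Defs.v *)
From HB Require Import structures.
From mathcomp Require Import all_boot all_order all_algebra all_fingroup.
From mathcomp Require Import all_classical all_reals all_analysis.

Set Implicit Arguments.
Unset Strict Implicit.
Unset Printing Implicit Defensive.

Import Order.TTheory GRing.Theory Num.Theory.
Import numFieldNormedType.Exports.

Local Open Scope classical_set_scope.
Local Open Scope ring_scope.

(* In finite dimension, f is of class C^(r+1) on the open set U iff it is
   (Frechet) differentiable there and all its directional derivatives are of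
   class C^r. *)
Fixpoint Cr {R : realType} {V W : normedModType R} (r : nat)
    (U : set V) (f : V -> W) : Prop :=
  match r with
  | 0 => forall u, U u -> {for u, continuous f}
  | r'.+1 => (forall u, U u -> differentiable f u) /\
             (forall v : V, Cr r' U ('D_v f))
  end.

Definition smooth {R : realType} {V W : normedModType R}
    (U : set V) (f : V -> W) : Prop := forall r, Cr r U f.

Definition locally_finite_family (T : topologicalType) (J : Type)
    (F : J -> set T) : Prop :=
  forall x : T, exists2 N : set T, nbhs x N &
    finite_set [set j | F j `&` N !=set0].

Definition paracompact (T : topologicalType) : Prop :=
  forall (J : Type) (F : J -> set T),
    (forall j, open (F j)) -> \bigcup_j F j = setT ->
    exists (K : Type) (G : K -> set T),
      [/\ forall k, open (G k), \bigcup_k G k = setT,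
          forall k, exists j, G k `<=` F j & locally_finite_family G].

Record manifold (R : realType) (m : nat) := Manifold {
  carrier :> topologicalType;
  carrier_hausdorff : hausdorff_space carrier;
  carrier_paracompact : paracompact carrier;
  chart : Type;
  dom : chart -> set carrier;
  coord : chart -> carrier -> 'rV[R]_m;
  param : chart -> 'rV[R]_m -> carrier;
  dom_open : forall c, open (dom c);
  dom_cover : \bigcup_c dom c = setT;
  cod_open : forall c, open (coord c @` dom c);
  coordK : forall c x, dom c x -> param c (coord c x) = x;
  coord_continuous : forall c x, dom c x -> {for x, continuous (coord c)};
  param_continuous : forall c u, (coord c @` dom c) u ->
    {for u, continuous (param c)};
  transition_smooth : forall c c',
    smooth (coord c @` (dom c `&` dom c')) (coord c' \o param c)
}.

Definition cod {R : realType} {m : nat} {M : manifold R m} (c : chart M) :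
  set 'rV[R]_m := coord c @` dom c.

(* A k-linear function on R^m takes its k arguments as the rows of a matrix. *)
Section Pointwise.
Context {R : realType} {m : nat}.

Definition mfun (k : nat) : Type := 'M[R]_(k, m) -> R.

Definition multilinear_fun k (f : mfun k) : Prop :=
  forall (A B C : 'M[R]_(k, m)) (i : 'I_k) (b c : R),
    row i A = b *: row i B + c *: row i C ->
    row' i B = row' i A -> row' i C = row' i A ->
    f A = b * f B + c * f C.

Definition alternating_fun k (f : mfun k) : Prop :=
  forall (A : 'M[R]_(k, m)) (i j : 'I_k), i != j -> row i A = row j A ->
    f A = 0.

Definition tensor k l (f : mfun k) (g : mfun l) : mfun (k + l) :=
  fun A => f (usubmx A) * g (dsubmx A).

(* Normalised so that (f /\ g)(v, w) = f(v) g(w) - f(w) g(v) in degree 1. *)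
Definition wedge k l (f : mfun k) (g : mfun l) : mfun (k + l) :=
  fun A => (k`! * l`!)%:R^-1 *
    \sum_(s : 'S_(k + l)) (-1) ^+ s * tensor f g (row_perm s A).

Fixpoint wedge_exp (f : mfun 2) (n : nat) : mfun (n * 2) :=
  match n with
  | 0 => fun=> 1
  | n'.+1 => wedge f (@wedge_exp f n')
  end.

Fixpoint wedge_family (p : nat) : ('I_p -> mfun 1) -> mfun p :=
  match p return ('I_p -> mfun 1) -> mfun p with
  | 0 => fun _ _ => 1
  | p'.+1 => fun t => wedge (t ord0) (wedge_family (fun i => t (lift ord0 i)))
  end.

(* The pullback of f by the endomorphism v |-> v *m L of row vectors. *)
Definition pullback k (L : 'M[R]_m) (f : mfun k) : mfun k :=
  fun A => f (A *m L).

Definition std (i : 'I_m) : 'rV[R]_m := delta_mx 0 i.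

(* With covectors written as rows in the dual basis, the map v |-> f(v, -)
   from vectors to covectors is right multiplication by [flat f]. *)
Definition flat (f : mfun 2) : 'M[R]_m :=
  \matrix_(i, j) f (@col_mx R 1 1 m (std i) (std j)).

Definition covector (f : mfun 1) : 'cV[R]_m := \col_i f (std i).

(* Subspaces of R^m are represented by matrices, through their row space. *)
Definition horizontal p (t : 'I_p -> mfun 1) : 'M[R]_m :=
  (\bigcap_(k < p) kermx (covector (t k)))%MS.

Definition vertical (w : mfun 2) : 'M[R]_m := kermx (flat w).

Definition pr_horizontal p (w : mfun 2) (t : 'I_p -> mfun 1) : 'M[R]_m :=
  proj_mx (horizontal t) (vertical w).

Definition assoc_tensor p (w : mfun 2) (t : 'I_p -> mfun 1) : mfun 2 :=
  fun A => w A + \sum_(k < p) (tensor (t k) (t k) : mfun 2) A.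

(* A bivector is a bilinear function of two covectors. [invmx] is the inverse
   as soon as the associated tensor is non-degenerate, which holds at every
   point of an almost cosymplectic manifold; similarly [proj_mx] is then a
   projection along a direct sum decomposition. *)
Definition assoc_bivector p (w : mfun 2) (t : 'I_p -> mfun 1) : mfun 2 :=
  fun A => - pullback (invmx (flat (assoc_tensor w t))) w A.

End Pointwise.
Arguments mfun : clear implicits.
Arguments wedge_exp {R m} f n.

(* Tensor fields on an open subset of R^m. *)
Section Local.
Context {R : realType} {m : nat}.

Definition lfield (k : nat) : Type := 'rV[R]_m -> mfun R m k.

(* d f (v_0, ..., v_k) = \sum_i (-1)^i v_i . f(v_0, ..., ^v_i, ..., v_k) for
   constant vector fields v_0, ..., v_k. *)
Definition ext_d k (f : lfield k) : lfield k.+1 :=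
  fun u A => \sum_(i < k.+1)
    (-1) ^+ i * 'D_(row i A) (fun x => f x (row' i A)) u.

Definition partial k (l : 'I_m) (f : lfield k) : lfield k :=
  fun u A => 'D_(std l) (fun x => f x A) u.

(* The Schouten-Nijenhuis bracket of multivector fields P, Q of degrees
   p + 1 and 1 + q (functions of covectors). It is the extension of the Lie
   bracket of vector fields satisfying [P, Q] = - (-1)^(pq) [Q, P] and
   [P, Q /\ S] = [P, Q] /\ S + (-1)^(p deg Q) Q /\ [P, S]; in coordinates,
     [P, Q] = \sum_l P(..., dx^l) /\ d_l Q - d_l P /\ Q(dx^l, ...). *)
Definition schouten p q (P : lfield (p + 1)) (Q : lfield (1 + q)) :
    lfield (p + (1 + q)) :=
  fun u A => \sum_(l < m)
    (wedge (fun X : 'M[R]_(p, m) => P u (col_mx X (std l))) (partial l Q u) A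
     - wedge (partial l P u) (fun X : 'M[R]_(q, m) => Q u (col_mx (std l) X))
         (castmx (addnA p 1 q, erefl m) A)).

End Local.
Arguments lfield : clear implicits.

(* A differential form is given by its local expressions on the images of the
   charts, subject to the change of coordinates formula; the operations on
   forms are performed on the local expressions. *)
Record diff_form {R : realType} {m : nat} (M : manifold R m) (k : nat) :=
  DiffForm {
  lexpr :> chart M -> lfield R m k;
  form_multilinear : forall c u, cod c u -> multilinear_fun (lexpr c u);
  form_alternating : forall c u, cod c u -> alternating_fun (lexpr c u);
  form_smooth : forall c (A : 'M[R]_(k, m)), smooth (cod c) (lexpr c ^~ A);
  form_compat : forall c c' u, (coord c @` (dom c `&` dom c')) u ->
    let psi := coord c' \o param c in
    lexpr c u = pullback (jacobian psi u) (lexpr c' (psi u))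
}.

Section Cosymplectic.
Context {R : realType} {m : nat} (M : manifold R m).

Definition tfield_zero k (T : chart M -> lfield R m k) : Prop :=
  forall (c : chart M) u, cod c u -> forall A, T c u A = 0.

Definition nowhere_zero k (T : chart M -> lfield R m k) : Prop :=
  forall (c : chart M) u, cod c u -> exists A, T c u A <> 0.

Definition almost_cosymplectic (n p : nat) (w : diff_form M 2)
    (t : 'I_p -> diff_form M 1) : Prop :=
  nowhere_zero (fun c u => wedge (wedge_exp (w c u) n)
                                 (wedge_family (fun k => t k c u))) /\
  tfield_zero (fun c u => wedge_exp (w c u) n.+1).

Definition cosymplectic_bivector p (w : diff_form M 2)
    (t : 'I_p -> diff_form M 1) : chart M -> lfield R m 2 :=
  fun c u => assoc_bivector (w c u) (fun k => t k c u).

Definition is_Poisson (L : chart M -> lfield R m 2) : Prop :=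
  tfield_zero (fun c => @schouten R m 1 1 (L c) (L c)).

(* (Lambda^j tpr_H)(d a), for a form a of degree j - 1. *)
Definition horizontal_d p (w : diff_form M 2) (t : 'I_p -> diff_form M 1) k
    (a : diff_form M k) : chart M -> lfield R m k.+1 :=
  fun c u => pullback (pr_horizontal (w c u) (fun i => t i c u))
                      (ext_d (a c) u).

End Cosymplectic.

(* Main.v *)
From Pilot Require Import Defs.
From mathcomp Require Import all_boot all_order all_algebra all_fingroup.
From mathcomp Require Import all_classical all_reals all_analysis.
From mathcomp Require Import ring lra.
(* Imported again because [mfun] is also a name of measure theory. *)
Import Pilot.Defs.

(** Everything happens at one point of one chart, where a 2-form is a skew
    matrix W, the 1-forms are the columns of a matrix a, and Lambda is the skew
    matrix P of [bivector_mx].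

    Linear algebra. That omega^n /\ tau_1 /\ ... /\ tau_p does not vanish says
    that no nonzero vector is killed by omega and by all the tau_k
    ([cosymplectic_injective]); that omega^(n+1) vanishes says that W has rank
    at most 2n ([rank_wedge_exp_eq0]), so that Ker omega has dimension at least
    p. Together they give vectors Z_1, ..., Z_p in Ker omega dual to the tau_k
    ([cosymplectic_dual_frame]), the Reeb vectors of the structure. Writing
    B = W + a a^T, one gets B^-1 a = Z^T, from which P a = 0,
    P W = 1 - Z^T a^T, P W P = P, and x W P = x for x horizontal: P and W are
    inverse to each other on H and its dual, and P kills the tau_k.

    Differential calculus. These identities hold near the point, so they can be
    differentiated. If beta and gamma vanish on V, differentiating P W P = P
    gives beta (dP) gamma^T = dW(beta P, gamma P), and differentiating P a = 0
    gives (dP) a = - P (da). The bracket [Lambda, Lambda] is twice the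
    Jacobiator, the alternating sum of (alpha P).Lambda(beta, gamma) with beta
    and gamma constant ([schoutenE]). Hence the Jacobiator of three covectors
    that vanish on V is d omega on the corresponding horizontal vectors
    ([jacobiator_form]), and that of alpha, beta, tau_k is
    - d tau_k(alpha P, beta P) ([jacobiator_cov]). As every covector is the sum
    of a covector vanishing on V and of a combination of the tau_k, the
    Jacobiator vanishes if and only if d omega and the d tau_k vanish on
    horizontal vectors ([jacobiator_eq0P]). *)

Set Implicit Arguments.
Unset Strict Implicit.
Unset Printing Implicit Defensive.

Import Order.TTheory GRing.Theory Num.Theory.
Import numFieldNormedType.Exports.

Local Open Scope ring_scope.

(** * Wedge products of functions of k vectors *)

Section Wedge.
Context {R : realType} {m : nat}.

Definition setrow k (i : 'I_k) (x : 'rV[R]_m) (A : 'M[R]_(k, m)) :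
  'M[R]_(k, m) :=
  \matrix_(a, j) if a == i then x 0 j else A a j.

Lemma row_setrow k (i : 'I_k) x (A : 'M[R]_(k, m)) : row i (setrow i x A) = x.
Proof. by apply/rowP => j; rewrite !mxE eqxx. Qed.

Lemma row_setrow_neq k (i i' : 'I_k) x (A : 'M[R]_(k, m)) :
  i' != i -> row i' (setrow i x A) = row i' A.
Proof. by move=> ne; apply/rowP => j; rewrite !mxE (negPf ne). Qed.

Lemma setrow_row k (i : 'I_k) (A : 'M[R]_(k, m)) : setrow i (row i A) A = A.
Proof. by apply/matrixP => a j; rewrite !mxE; case: eqP => // ->. Qed.

Lemma row'_setrow k (i : 'I_k) x (A : 'M[R]_(k, m)) :
  row' i (setrow i x A) = row' i A.
Proof. by apply/matrixP => a j; rewrite !mxE eq_sym (negPf (neq_lift _ _)). Qed.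

Lemma row_perm_setrow k (s : 'S_k) (i : 'I_k) x (A : 'M[R]_(k, m)) :
  row_perm s (setrow i x A) = setrow (s^-1%g i) x (row_perm s A).
Proof.
by apply/matrixP => a j; rewrite !mxE -[a == _](inj_eq (@perm_inj _ s)) permKV.
Qed.

Lemma usubmx_setrow_l k l (i : 'I_k) x (A : 'M[R]_(k + l, m)) :
  usubmx (setrow (lshift l i) x A) = setrow i x (usubmx A).
Proof. by apply/matrixP => a j; rewrite !mxE eq_lshift. Qed.

Lemma usubmx_setrow_r k l (i : 'I_l) x (A : 'M[R]_(k + l, m)) :
  usubmx (setrow (rshift k i) x A) = usubmx A.
Proof. by apply/matrixP => a j; rewrite !mxE eq_lrshift. Qed.

Lemma dsubmx_setrow_l k l (i : 'I_k) x (A : 'M[R]_(k + l, m)) :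
  dsubmx (setrow (lshift l i) x A) = dsubmx A.
Proof. by apply/matrixP => a j; rewrite !mxE eq_rlshift. Qed.

Lemma dsubmx_setrow_r k l (i : 'I_l) x (A : 'M[R]_(k + l, m)) :
  dsubmx (setrow (rshift k i) x A) = setrow i x (dsubmx A).
Proof. by apply/matrixP => a j; rewrite !mxE eq_rshift. Qed.

(** Multilinearity in a form that composes with [tensor] and with permutations
    of the rows, since [setrow] names the row that varies. *)
Definition rowlinear k (f : mfun R m k) := forall A i b c x y,
  f (setrow i (b *: x + c *: y) A) =
    b * f (setrow i x A) + c * f (setrow i y A).

Lemma multilinear_rowlinear k (f : mfun R m k) :
  multilinear_fun f -> rowlinear f.
Proof.
by move=> lf A i b c x y; apply: (lf _ _ _ i); rewrite ?row_setrow ?row'_setrow.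
Qed.

Lemma rowlinear0 k (f : mfun R m k) A i : rowlinear f -> f (setrow i 0 A) = 0.
Proof.
by move=> /(_ A i 0 0 0 0); rewrite !scale0r addr0 !mul0r addr0.
Qed.

Lemma rowlinearZ k (f : mfun R m k) A i b x : rowlinear f ->
  f (setrow i (b *: x) A) = b * f (setrow i x A).
Proof.
by move=> lf; rewrite -[b *: x]addr0 -[0 in LHS](scale0r 0) lf mul0r addr0.
Qed.

Lemma rowlinear_sum k (f : mfun R m k) A i l (v : 'rV[R]_l) (X : 'M[R]_(l, m)) :
  rowlinear f ->
  f (setrow i (v *m X) A) = \sum_j v 0 j * f (setrow i (row j X) A).
Proof.
move=> lf; rewrite mulmx_sum_row.
elim/big_rec2: _ => [|j s y _ <-]; first exact: rowlinear0.
by rewrite -[y in LHS]scale1r lf mul1r.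
Qed.

Lemma tensor_rowlinear k l (f : mfun R m k) (g : mfun R m l) :
  rowlinear f -> rowlinear g -> rowlinear (tensor f g).
Proof.
move=> lf lg A i b c x y; rewrite /tensor -[i]splitK.
case: (fintype.split i) => j /=.
  by rewrite !usubmx_setrow_l !dsubmx_setrow_l lf; ring.
by rewrite !usubmx_setrow_r !dsubmx_setrow_r lg; ring.
Qed.

Lemma wedge_rowlinear k l (f : mfun R m k) (g : mfun R m l) :
  rowlinear f -> rowlinear g -> rowlinear (wedge f g).
Proof.
move=> lf lg A i b c x y; rewrite /wedge !mulr_sumr -big_split /=.
apply: eq_bigr => s _; rewrite !row_perm_setrow tensor_rowlinear //.
by move: (_%:R^-1) ((-1) ^+ s) => c0 e; ring.
Qed.

(** The interior product of f by x is zero, in whichever slot x is put. *)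
Definition annihilates k (f : mfun R m k) x := forall A i, f (setrow i x A) = 0.

(** Interior products are antiderivations: if both factors are killed by x, so
    is every term of the antisymmetrised sum. *)
Lemma wedge_annihilates k l (f : mfun R m k) (g : mfun R m l) x :
  annihilates f x -> annihilates g x -> annihilates (wedge f g) x.
Proof.
move=> fx gx A i; rewrite /wedge big1 ?mulr0 // => s _.
rewrite row_perm_setrow /tensor -[_ i]splitK.
case: (fintype.split _) => j /=.
  by rewrite usubmx_setrow_l fx mul0r mulr0.
by rewrite dsubmx_setrow_r gx !mulr0.
Qed.

Lemma wedge_row_perm k l (f : mfun R m k) (g : mfun R m l) (s : 'S_(k + l)) A :
  wedge f g (row_perm s A) = (-1) ^+ s * wedge f g A.
Proof.
rewrite /wedge mulrCA; congr (_ * _); rewrite mulr_sumr.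
rewrite (reindex_inj (mulIg s^-1%g)); apply: eq_bigr => r _ /=.
by rewrite -row_permM mulgKV odd_permM odd_permV signr_addb -mulrA mulrCA.
Qed.

(** An antisymmetrised sum is alternating: the transposition of the two equal
    rows fixes A and changes the sign. *)
Lemma wedge_eq_rows k l (f : mfun R m k) (g : mfun R m l) A i j :
  i != j -> row i A = row j A -> wedge f g A = 0.
Proof.
move=> ne eqA.
have: wedge f g (row_perm (tperm i j) A) = wedge f g A.
  congr (wedge f g _); apply/row_matrixP => a.
  rewrite row_permEsub row_rowsub; case: tpermP => // ->; exact: esym.
rewrite wedge_row_perm odd_tperm ne expr1 mulN1r => /eqP.
by rewrite eq_sym -subr_eq0 opprK -mulr2n mulrn_eq0 /= => /eqP.
Qed.

Lemma wedge_exp_rowlinear (w : mfun R m 2) n :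
  rowlinear w -> rowlinear (wedge_exp w n).
Proof.
by move=> lw; elim: n => [|n IH]; [move=> A []|exact: (wedge_rowlinear lw IH)].
Qed.

Lemma wedge_exp_annihilates (w : mfun R m 2) n x :
  annihilates w x -> annihilates (wedge_exp w n) x.
Proof.
move=> wx; elim: n => [|n IH]; first by move=> A [].
exact: (wedge_annihilates wx IH).
Qed.

Lemma wedge_exp_row_perm (w : mfun R m 2) n (s : 'S_(n * 2)) A :
  wedge_exp w n (row_perm s A) = (-1) ^+ s * wedge_exp w n A.
Proof.
case: n s A => [|n] s A /=; last exact: (@wedge_row_perm 2 (n * 2)).
by rewrite (_ : s = 1%g) ?odd_perm1 ?mul1r //; apply/permP => -[].
Qed.

Lemma wedge_family_rowlinear p (t : 'I_p -> mfun R m 1) :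
  (forall k, rowlinear (t k)) -> rowlinear (wedge_family t).
Proof.
elim: p t => [|p IH] t lt; first by move=> A [].
exact: (wedge_rowlinear (lt ord0) (IH _ _)).
Qed.

Lemma wedge_family_annihilates p (t : 'I_p -> mfun R m 1) x :
  (forall k, annihilates (t k) x) -> annihilates (wedge_family t) x.
Proof.
elim: p t => [|p IH] t lt; first by move=> A [].
exact: (wedge_annihilates (lt ord0) (IH _ _)).
Qed.

(** A permutation of k+1 indices is determined by the image i of a chosen j
    and by the permutation r that it induces between the complements; this is
    what turns antisymmetrised sums into expansions along a row. *)
Lemma sum_perm_lift k (j : 'I_k.+1) (F : 'S_k.+1 -> R) :
  \sum_(s : 'S_k.+1) (-1) ^+ s * F s =
  \sum_(i < k.+1) \sum_(r : 'S_k)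
    (-1) ^+ (i + j) * ((-1) ^+ r * F (lift_perm j i r)).
Proof.
rewrite pair_bigA (reindex (fun ir => lift_perm j ir.1 ir.2)) /=; last first.
  apply: onW_bij; apply: inj_card_bij => [[i r] [i' r'] /= eq_lift|].
    have eqi : i = i' by rewrite -(lift_perm_id j i r) eq_lift lift_perm_id.
    rewrite {i}eqi in eq_lift *; congr (_, _); apply/permP => a.
    by apply: (@lift_inj _ i'); rewrite -!(lift_perm_lift j) eq_lift.
  have card_perms n : #|{: 'S_n}| = n`!.
    by rewrite -[RHS]card_Sn; apply: eq_card => s; rewrite !inE.
  by rewrite card_prod card_ord !card_perms.
apply: eq_bigr => -[i r] _ /=.
rewrite odd_lift_perm !signr_addb !signr_odd exprD.
by rewrite -!mulrA [_ ^+ j * _]mulrCA.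
Qed.

Lemma row_row_perm_lift k (j i : 'I_k.+1) (r : 'S_k) (A : 'M[R]_(k.+1, m)) :
  row j (row_perm (lift_perm j i r) A) = row i A.
Proof. by apply/rowP => a; rewrite !mxE lift_perm_id. Qed.

Lemma row'_row_perm_lift k (j i : 'I_k.+1) (r : 'S_k) (A : 'M[R]_(k.+1, m)) :
  row' j (row_perm (lift_perm j i r) A) = row_perm r (row' i A).
Proof. by apply/matrixP => a b; rewrite !mxE lift_perm_lift. Qed.

(** An iterated wedge has this property by [wedge_row_perm]. It makes equal
    all the terms of an antisymmetrised sum that put the same row first. *)
Definition skew k (f : mfun R m k) :=
  forall (s : 'S_k) A, f (row_perm s A) = (-1) ^+ s * f A.

Lemma sum_skew k (f : mfun R m k) A : skew f ->
  \sum_(s : 'S_k) (-1) ^+ s * f (row_perm s A) = k`!%:R * f A.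
Proof.
move=> af; rewrite (eq_bigr (fun=> f A)) => [|s _].
  by rewrite sumr_const mulr_natl -[in RHS]card_Sn; congr (_ *+ _).
by rewrite af mulrA -signr_addb addbb mul1r.
Qed.

Lemma factr_neq0 k : (k`!%:R : R) != 0.
Proof. by rewrite pnatr_eq0 -lt0n fact_gt0. Qed.

(** The k! terms of the antisymmetrised sum with the same row in f are equal,
    as g is skew, and they cancel the normalisation. *)
Lemma wedge1l k (f : mfun R m 1) (g : mfun R m k) (A : 'M[R]_(1 + k, m)) :
  skew g ->
  wedge f g A = \sum_(i < 1 + k) (-1) ^+ i * (f (row i A) * g (row' i A)).
Proof.
move=> ag; rewrite /wedge.
rewrite (sum_perm_lift ord0 (fun s => tensor f g (row_perm s A))).
rewrite mulr_sumr; apply: eq_bigr => i _.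
have ten r : tensor f g (row_perm (lift_perm ord0 i r) A) =
   f (row i A) * g (row_perm r (row' i A)).
  rewrite /tensor -(row_row_perm_lift ord0 i r) -(row'_row_perm_lift ord0).
  congr (f _ * g _); apply/matrixP => a b; rewrite !mxE ?(ord1 a).
    by congr (A (lift_perm _ _ _ _) _); apply/val_inj.
  by congr (A (lift_perm _ _ _ _) _); apply/val_inj.
under eq_bigr do rewrite ten addn0 [_ * (f _ * _)]mulrCA.
rewrite -mulr_sumr -mulr_sumr sum_skew // mul1n.
by rewrite mulrCA; congr (_ * _); rewrite mulrCA mulKf ?factr_neq0.
Qed.

End Wedge.

(** * Powers of a 2-form and the rank of its matrix *)

Section SkewForm.
Context {R : realType} {m : nat}.

Definition bil (W : 'M[R]_m) (x y : 'rV[R]_m) : R := (x *m W *m y^T) 0 0.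

Definition bilform (W : 'M[R]_m) : mfun R m 2 :=
  fun A => bil W (row ord0 A) (row ord_max A).

(** Plays the part of [col_mx x A], but with a height k.+1 that matches [row']
    and [lift ord0], so that expansions along rows need no cast. *)
Definition consrow k (x : 'rV[R]_m) (A : 'M[R]_(k, m)) : 'M[R]_(k.+1, m) :=
  \matrix_(i, j) oapp (A ^~ j) (x 0 j) (unlift ord0 i).

Lemma row_consrow0 k x (A : 'M[R]_(k, m)) : row ord0 (consrow x A) = x.
Proof. by apply/rowP => j; rewrite !mxE unlift_none. Qed.

Lemma row_consrow_lift k x (A : 'M[R]_(k, m)) i :
  row (lift ord0 i) (consrow x A) = row i A.
Proof. by apply/rowP => j; rewrite !mxE liftK. Qed.

Lemma row'_consrow0 k x (A : 'M[R]_(k, m)) : row' ord0 (consrow x A) = A.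
Proof. by apply/matrixP => i j; rewrite !mxE liftK. Qed.

Lemma row'_consrow_lift k x (A : 'M[R]_(k.+1, m)) i :
  row' (lift ord0 i) (consrow x A) = consrow x (row' i A).
Proof.
apply/matrixP => a j; rewrite !mxE.
case: (unliftP ord0 a) => [b ->|->] /=.
  rewrite (_ : lift (lift ord0 i) (lift ord0 b) = lift ord0 (lift i b)).
    by rewrite liftK /= !mxE.
  by apply/val_inj; rewrite /= /bump /= !add1n ltnS addnS.
by rewrite (_ : lift (lift ord0 i) ord0 = ord0) ?unlift_none //; apply/val_inj.
Qed.

Lemma row_row' k (A : 'M[R]_(k.+1, m)) i a :
  row a (row' i A) = row (lift i a) A.
Proof. by apply/rowP => j; rewrite !mxE. Qed.

Lemma bilE W x y : bil W x y = \sum_i x 0 i * (W *m y^T) i 0.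
Proof. by rewrite /bil -mulmxA !mxE. Qed.

Lemma bil_skew (W : 'M[R]_m) x y : W^T = - W -> bil W y x = - bil W x y.
Proof.
move=> WT; rewrite /bil (_ : y *m W *m x^T = - (x *m W *m y^T)^T) ?mxE//.
by rewrite !trmx_mul trmxK WT mulNmx mulmxN opprK mulmxA.
Qed.

(** [sum_perm_lift] is applied twice, to choose the two arguments of the
    2-form. The factor 1/2 is there because each pair of rows is met in both
    orders. *)
Lemma wedge_bilform k (W : 'M[R]_m) (g : mfun R m k) (A : 'M[R]_(2 + k, m)) :
  skew g ->
  wedge (bilform W) g A = 2^-1 *
    \sum_(i < k.+2) \sum_(j < k.+1) (-1) ^+ (i + j) *
    (bil W (row i A) (row j (row' i A)) * g (row' j (row' i A))).
Proof.
move=> sg; rewrite /wedge natrM invfM -mulrA; congr (_ * _).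
rewrite (sum_perm_lift ord0 (fun s => tensor (bilform W) g (row_perm s A))).
rewrite mulr_sumr; apply: eq_bigr => i _.
rewrite -mulr_sumr addn0.
rewrite (sum_perm_lift ord0 (fun r => tensor (bilform W) g
  (row_perm (lift_perm ord0 i r) A))).
rewrite !mulr_sumr; apply: eq_bigr => j _.
have ten q : tensor (bilform W) g
    (row_perm (lift_perm ord0 i (lift_perm ord0 j q)) A) =
   bil W (row i A) (row j (row' i A)) * g (row_perm q (row' j (row' i A))).
  rewrite -(row'_row_perm_lift ord0) -(row'_row_perm_lift ord0).
  rewrite -(row_row_perm_lift ord0 j q) -(row'_row_perm_lift ord0).
  rewrite -(row_row_perm_lift ord0 i (lift_perm ord0 j q)).
  rewrite /tensor /bilform; move: (row_perm _ _) => B.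
  congr (bil _ _ _ * g _); try apply/rowP => a; try apply/matrixP => a b.
  - by rewrite !mxE; congr (B _ _); apply/val_inj.
  - by rewrite !mxE; congr (B _ _); apply/val_inj.
  - by rewrite !mxE; congr (B _ _); apply/val_inj.
under eq_bigr do rewrite ten addn0 [_ * (bil _ _ _ * _)]mulrCA.
rewrite -!mulr_sumr sum_skew // exprD -mulrA mulrCA; congr (_ * _).
by rewrite mulrCA; congr (_ * _); rewrite mulrCA mulKf ?factr_neq0.
Qed.

Lemma sum_ord2 k (F : 'I_k.+2 -> R) :
  \sum_i F i =
  F ord0 + (F (lift ord0 ord0) + \sum_(a < k) F (lift ord0 (lift ord0 a))).
Proof. by rewrite 2!big_ord_recl. Qed.

(** In the expansion, x and y can only be paired with each other: the two
    orders give the first term, and the sum collects the pairs taken among the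
    rows of h. *)
Lemma wedge_bilform_orthogonal k (W : 'M[R]_m) (g : mfun R m k) x y
    (h : 'M[R]_(k, m)) :
  W^T = - W -> (forall i, bil W x (row i h) = 0) ->
  (forall i, bil W y (row i h) = 0) -> skew g ->
  wedge (bilform W) g (consrow x (consrow y h)) =
    bil W x y * g h +
    2^-1 * \sum_(a < k) \sum_(j < k.+1) (-1) ^+ (a + j) *
      (bil W (row a h) (row j (consrow x (row' (lift ord0 a) (consrow y h)))) *
       g (row' j (consrow x (row' (lift ord0 a) (consrow y h))))).
Proof.
move=> WT xh yh sg; rewrite wedge_bilform // sum_ord2.
have yx : bil W y x = - bil W x y by exact: bil_skew.
rewrite (big_ord_recl k) [X in _ + (X + _)]big_ord_recl.
rewrite !row_consrow0 !row_consrow_lift !row'_consrow0 !row'_consrow_lift.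
rewrite !row_consrow0 !row'_consrow0 yx.
rewrite [X in _ + X + _]big1; last first.
  by move=> j _; rewrite row_consrow_lift xh mul0r mulr0.
rewrite [X in _ + (_ + X + _)]big1; last first.
  by move=> j _; rewrite row_consrow_lift yh mul0r mulr0.
rewrite !addr0 addn0 expr1 mulrDr mulrDr addrA.
congr (_ + _).
  rewrite (_ : (-1) ^+ _ = 1) // mul1r mulN1r mulNr opprK -mulrDl.
  by rewrite -[X in X + X]mulr1 -mulrDr mulVf ?mul1r // pnatr_eq0.
congr (_ * _); apply: eq_bigr => a _; apply: eq_bigr => j _.
rewrite !row_consrow_lift row'_consrow_lift; congr (_ * _).
by rewrite /= /bump /= !add1n !addSn !exprS !mulN1r opprK.
Qed.

(** Omega^(n+1) restricted to the sum of the plane spanned by x and y and of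
    its orthogonal is n+1 times omega(x, y) omega^n. In the induction, pairing
    x with y at once gives one copy, and pairing two rows of h first gives n
    copies, by the induction hypothesis and the expansion of omega^n. *)
Lemma wedge_exp_orthogonal (W : 'M[R]_m) n x y (h : 'M[R]_(n * 2, m)) :
  W^T = - W -> (forall i, bil W x (row i h) = 0) ->
  (forall i, bil W y (row i h) = 0) ->
  wedge_exp (bilform W) n.+1 (consrow x (consrow y h)) =
    n.+1%:R * bil W x y * wedge_exp (bilform W) n h.
Proof.
move=> WT; elim: n h => [|n IH] h xh yh.
  rewrite [LHS](@wedge_bilform_orthogonal _ W (wedge_exp (bilform W) 0)
    x y h WT xh yh); last first.
    exact: (@wedge_exp_row_perm _ _ _ 0).
  by rewrite big_ord0 mulr0 addr0 mul1r.
rewrite [LHS](@wedge_bilform_orthogonal _ W (wedge_exp (bilform W) n.+1)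
  x y h WT xh yh); last first.
  exact: (@wedge_exp_row_perm _ _ _ n.+1).
have skn : skew (wedge_exp (bilform W) n) by exact: wedge_exp_row_perm.
have defh := @wedge_bilform _ W _ h skn.
have hx a : bil W (row a h) x = 0 by rewrite bil_skew // xh oppr0.
have hy a : bil W (row a h) y = 0 by rewrite bil_skew // yh oppr0.
have inner (a : 'I_(n * 2).+2) : \sum_(j < (n * 2).+3) (-1) ^+ (a + j) *
      (bil W (row a h) (row j (consrow x (row' (lift ord0 a) (consrow y h)))) *
       wedge_exp (bilform W) n.+1
         (row' j (consrow x (row' (lift ord0 a) (consrow y h))))) =
   n.+1%:R * bil W x y * \sum_(j < (n * 2).+1) (-1) ^+ (a + j) *
     (bil W (row a h) (row j (row' a h)) *
      wedge_exp (bilform W) n (row' j (row' a h))).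
  rewrite sum_ord2 row'_consrow_lift.
  rewrite !row_consrow_lift !row_consrow0 hx hy !(mul0r, mulr0, add0r).
  rewrite mulr_sumr; apply: eq_bigr => j _.
  rewrite !row_consrow_lift !row'_consrow_lift IH => [|i|i].
  - rewrite /= /bump /= !add1n !addnS !exprS !mulN1r opprK.
    move: (wedge_exp _ _ _) (_ ^+ _) (bil W (row a h) _) (bil W x y) => u v b c.
    by move: (_%:R) => d; ring.
  - by rewrite !row_row'.
  - by rewrite !row_row'.
under eq_bigr do rewrite inner.
rewrite -mulr_sumr [X in _ + X]mulrCA -defh.
rewrite -[n.+2]add1n natrD -mulrA -mulrA mulrDl mul1r.
by rewrite -[wedge_exp _ n.+1 h]/(wedge _ _ h).
Qed.

Lemma wedge_exp1 (W : 'M[R]_m) :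
  W^T = - W -> wedge_exp (bilform W) 1 = bilform W.
Proof.
move=> WT; apply: funext => A.
have -> : A = consrow (row ord0 A) (consrow (row ord_max A) (0 : 'M[R]_(0, m))).
  apply/row_matrixP => i; case: (unliftP ord0 i) => [j|] ->.
    rewrite row_consrow_lift ord1 row_consrow0; congr (row _ A).
    exact/val_inj.
  by rewrite row_consrow0.
rewrite (wedge_exp_orthogonal (n := 0)) => [|//|[]//|[]//].
rewrite /bilform row_consrow0 mul1r mulr1; congr (bil W _ _).
rewrite (_ : ord_max = lift ord0 (ord0 : 'I_1)); last exact/val_inj.
by rewrite row_consrow_lift row_consrow0.
Qed.

Lemma bilform_skew (W : 'M[R]_m) : W^T = - W -> skew (bilform W).
Proof.
move=> WT; rewrite -wedge_exp1 // => s A.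
exact: (@wedge_exp_row_perm R m _ 1).
Qed.

Lemma wedge_mulmx k l (f : mfun R m k) (g : mfun R m l) (L : 'M[R]_m) A :
  wedge f g (A *m L) = wedge (pullback L f) (pullback L g) A.
Proof.
congr (_ * _); apply: eq_bigr => s _.
by rewrite /tensor /pullback; congr (_ * (f _ * g _));
  apply/matrixP => i j; rewrite !mxE; apply: eq_bigr => a _; rewrite !mxE.
Qed.

Lemma wedge_exp_mulmx (W L : 'M[R]_m) n A :
  wedge_exp (bilform W) n (A *m L) = wedge_exp (bilform (L *m W *m L^T)) n A.
Proof.
elim: n A => [//|n IH] A; rewrite [LHS]wedge_mulmx /=; congr (wedge _ _ A).
  apply: funext => B; rewrite /pullback /bilform /bil !row_mul trmx_mul.
  by rewrite !mulmxA.
by apply: funext => B; exact: IH.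
Qed.

Lemma bil_delta (W : 'M[R]_m) i j : bil W (delta_mx 0 i) (delta_mx 0 j) = W i j.
Proof. by rewrite /bil -rowE trmx_delta -colE !mxE. Qed.

(** If omega(x, y) is nonzero, the projection L onto the orthogonal of x and y
    turns omega into a form whose n-th power vanishes by
    [wedge_exp_orthogonal], while the rank drops by at most 2. The conclusion
    follows by induction on n. *)
Lemma rank_wedge_exp_eq0 (W : 'M[R]_m) n : W^T = - W ->
  (forall A, wedge_exp (bilform W) n.+1 A = 0) -> (\rank W <= 2 * n)%N.
Proof.
elim: n W => [|n IH] W WT W0.
  suff -> : W = 0 by rewrite mxrank0.
  apply/matrixP => i j; rewrite mxE -bil_delta.
  have := @wedge_exp_orthogonal W 0 (delta_mx 0 i) (delta_mx 0 j) 0 WT.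
  by rewrite W0 mul1r mulr1 => <- // -[].
have [->|] := eqVneq W 0; first by rewrite mxrank0.
case/matrix0Pn => i [j]; rewrite -bil_delta.
set x := delta_mx 0 i; set y := delta_mx 0 j; set c := bil W x y => c0.
have xx v : bil W v v = 0.
  by have := bil_skew v v WT; lra.
(* v *m L = v - w(v, y) / c *: x + w(v, x) / c *: y is orthogonal to x and y *)
pose p := W *m y^T; pose q := W *m x^T.
pose L := 1%:M - c^-1 *: (p *m x) + c^-1 *: (q *m y) : 'M[R]_m.
have bsc u v : u *m (W *m v^T) = (bil W u v)%:M.
  by rewrite mulmxA [LHS]mx11_scalar.
have LW : L *m W = W - c^-1 *: (p *m (x *m W)) + c^-1 *: (q *m (y *m W)).
  by rewrite !mulmxDl mul1mx mulNmx -!scalemxAl -!(mulmxA p) -!(mulmxA q).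
have Lp : L *m W *m y^T = 0.
  rewrite -mulmxA -/p !mulmxDl mul1mx mulNmx -!scalemxAl.
  rewrite -!(mulmxA p) -!(mulmxA q) !bsc xx.
  rewrite !mul_mx_scalar scale0r scaler0 addr0 scalerA mulVf //.
  by rewrite scale1r subrr.
have Lq : L *m W *m x^T = 0.
  rewrite -mulmxA -/q !mulmxDl mul1mx mulNmx -!scalemxAl.
  rewrite -!(mulmxA p) -!(mulmxA q) !bsc xx.
  rewrite (bil_skew _ _ WT) -/c.
  rewrite !mul_mx_scalar scale0r scaler0 subr0 scaleNr scalerN scalerA mulVf //.
  by rewrite scale1r subrr.
have LWL : L *m W *m L^T = L *m W.
  have -> : L^T = 1%:M - c^-1 *: (x^T *m p^T) + c^-1 *: (y^T *m q^T).
    by rewrite !linearD linearN /= trmx1 !linearZ /= !trmx_mul.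
  rewrite !mulmxDr mulmx1 mulmxN -!scalemxAr !mulmxA Lp Lq !mul0mx !scaler0.
  by rewrite subr0 addr0.
have rkL : (\rank (L *m W) <= 2 * n)%N.
  apply: IH => [|A].
    by rewrite -LWL !trmx_mul trmxK WT mulNmx mulmxN mulmxA.
  rewrite -LWL -wedge_exp_mulmx.
  have ort v : L *m W *m v^T = 0 -> forall a, bil W v (row a (A *m L)) = 0.
    move=> Lv a; rewrite bil_skew // /bil row_mul -!mulmxA [L *m _]mulmxA Lv.
    by rewrite mulmx0 mxE oppr0.
  have := @wedge_exp_orthogonal W n.+1 x y (A *m L) WT (ort x Lq) (ort y Lp).
  rewrite W0; move: (wedge_exp _ n.+1 _) => z /esym/eqP.
  by rewrite !mulf_eq0 pnatr_eq0 (negPf c0) => /eqP.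
have -> : W = L *m W + (c^-1 *: p *m (x *m W) - c^-1 *: q *m (y *m W)).
  rewrite LW -!scalemxAl.
  by move: (c^-1 *: _) (c^-1 *: _) => a b; rewrite -addrA [a + _]addrC !subrK.
apply: (leq_trans (mxrank_add _ _)); rewrite mulnS addnC leq_add //.
apply: (leq_trans (mxrank_add _ _)).
rewrite mxrank_opp (leq_add (n1 := 1) (n2 := 1)) //.
  exact: mulmx_max_rank.
exact: mulmx_max_rank.
Qed.
End SkewForm.

(** * The linear algebra of an almost cosymplectic structure *)

Section CosymplecticAlgebra.
Context {R : realType} {m p : nat}.
Implicit Types (W : 'M[R]_m) (a : 'M[R]_(m, p)).

Definition linform (b : 'cV[R]_m) : mfun R m 1 := fun A => (A *m b) 0 0.

Lemma setrow1 (i : 'I_1) x (A : 'M[R]_(1, m)) : setrow i x A = x.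
Proof. by apply/matrixP => k j; rewrite !mxE !ord1 eqxx. Qed.

Lemma linform_rowlinear (b : 'cV[R]_m) : rowlinear (linform b).
Proof.
move=> A i c d x y; rewrite !setrow1 /linform mulmxDl -!scalemxAl.
by rewrite !mxE.
Qed.

Lemma bilform_rowlinear W : rowlinear (bilform W).
Proof.
move=> A i c d x y; rewrite /bilform /bil.
have [->|ne0] := eqVneq i ord0.
  rewrite !row_setrow !(@row_setrow_neq _ _ _ ord0 ord_max) //.
  by rewrite !mulmxDl -!scalemxAl !mxE.
have -> : i = ord_max by apply/val_inj; case: i ne0 => -[|[]].
rewrite !row_setrow !(@row_setrow_neq _ _ _ ord_max ord0) //.
by rewrite linearD !linearZ /= mulmxDr -!scalemxAr !mxE.
Qed.

Lemma bilform_annihilates W x :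
  W^T = - W -> x *m W = 0 -> annihilates (bilform W) x.
Proof.
move=> WT xW A i; rewrite /bilform.
have [->|ne0] := eqVneq i ord0.
  by rewrite row_setrow /bil xW mul0mx mxE.
have -> : i = ord_max by apply/val_inj; case: i ne0 => -[|[]].
by rewrite row_setrow bil_skew // /bil xW mul0mx mxE oppr0.
Qed.

(** An alternating form of top degree that is killed by a nonzero vector x is
    zero. If the rows of A are independent, x is a combination of them; if
    they are not, 0 is a nontrivial one. Replacing the i-th row of A by that
    combination multiplies f A by the i-th coefficient and gives 0, so it
    suffices to choose i with a nonzero coefficient. *)
Lemma annihilated_eq0 k (f : mfun R m k) A x :
  rowlinear f -> (forall B i j, i != j -> row i B = row j B -> f B = 0) ->
  k = m -> f A <> 0 -> annihilates f x -> x = 0.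
Proof.
move=> lf af km fA fx; have [//|x0] := eqVneq x 0.
(* b is 1 when the rows of A are independent and 0 otherwise *)
have [c [b [c0 cA]]] : exists (c : 'rV_k) (b : R), c != 0 /\ c *m A = b *: x.
  have [fr|] := boolP (row_free A).
    have /submxP[c xc] : (x <= A)%MS.
      by rewrite submx_full // /row_full (eqP fr) km.
    exists c, 1; rewrite scale1r; split=> //.
    by apply: contra_neq x0 => c0; rewrite xc c0 mul0mx.
  rewrite -kermx_eq0 => /rowV0Pn[c /sub_kermxP cA c0].
  by exists c, 0; rewrite scale0r.
have [i ci] : exists i, c 0 i != 0.
  by case/matrix0Pn: c0 => i0 [i]; rewrite ord1; exists i.
case: fA; have : f (setrow i (c *m A) A) = 0.
  by rewrite cA rowlinearZ // fx mulr0.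
rewrite rowlinear_sum // (bigD1 i) //= setrow_row big1 ?addr0.
  by move/eqP; rewrite mulf_eq0 (negPf ci) => /eqP.
move=> j ji; rewrite (af _ i j) ?mulr0 1?eq_sym //.
by rewrite row_setrow row_setrow_neq.
Qed.

Definition cosymplectic_at W a n :=
  (exists A : 'M[R]_(n * 2 + p, m),
     wedge (wedge_exp (bilform W) n)
       (wedge_family (fun k : 'I_p => linform (col k a))) A <> 0) /\
  forall A, wedge_exp (bilform W) n.+1 A = 0.

Lemma cosymplectic_injective W a n (x : 'rV[R]_m) :
  W^T = - W -> cosymplectic_at W a n -> (n * 2 + p)%N = m ->
  x *m W = 0 -> x *m a = 0 -> x = 0.
Proof.
move=> WT [[A topA] _] nm xW xa; apply: annihilated_eq0 topA _ => //.
- apply: wedge_rowlinear.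
    exact: wedge_exp_rowlinear (bilform_rowlinear W).
  by apply: wedge_family_rowlinear => k; exact: linform_rowlinear.
- by move=> B i j; exact: wedge_eq_rows.
- apply: wedge_annihilates.
    exact: wedge_exp_annihilates (bilform_annihilates WT xW).
  apply: wedge_family_annihilates => k B i; rewrite setrow1 /linform.
  by rewrite colE mulmxA xa mul0mx mxE.
Qed.

(** Ker omega has dimension at least p by the rank bound, and a is injective
    on it by [cosymplectic_injective]; so a maps it onto R^p, and the standard
    basis of R^p has preimages there. *)
Lemma cosymplectic_dual_frame W a n :
  W^T = - W -> cosymplectic_at W a n -> (n * 2 + p)%N = m ->
  exists Z : 'M[R]_(p, m), Z *m W = 0 /\ Z *m a = 1%:M.
Proof.
move=> WT cWa nm; have inj x := @cosymplectic_injective W a n x WT cWa nm.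
have rkW : (\rank W <= 2 * n)%N by apply: rank_wedge_exp_eq0 => //; case: cWa.
have rkVa : \rank (kermx W *m a) = \rank (kermx W).
  rewrite -[RHS](mxrank_mul_ker _ a) (_ : (_ :&: _)%MS = 0) ?mxrank0 ?addn0 //.
  apply/eqP/rowV0P => x.
  rewrite sub_capmx => /andP[/sub_kermxP xW /sub_kermxP xa].
  exact: inj.
have /row_fullP[Y Y1] : row_full (kermx W *m a).
  rewrite /row_full eqn_leq rank_leq_col rkVa mxrank_ker.
  rewrite leq_subRL ?rank_leq_row //.
  by rewrite -[X in (_ <= X)%N]nm leq_add2r mulnC.
exists (Y *m kermx W); split; last by rewrite -mulmxA.
by rewrite -mulmxA (sub_kermxP (submx_refl _)) mulmx0.
Qed.

Definition assoc_mx W a : 'M[R]_m := W + a *m a^T.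

(** The matrix of (alpha, beta) |-> - omega(alpha B^-1, beta B^-1), where
    covectors are rows and B^-1 acts on the right. *)
Definition bivector_mx W a : 'M[R]_m :=
  - (invmx (assoc_mx W a) *m W *m (invmx (assoc_mx W a))^T).

Section Frame.
Variables (W : 'M[R]_m) (a : 'M[R]_(m, p)) (Z : 'M[R]_(p, m)).
Hypotheses (WT : W^T = - W) (ZW : Z *m W = 0) (Za : Z *m a = 1%:M).
Hypothesis inj : forall x : 'rV_m, x *m W = 0 -> x *m a = 0 -> x = 0.
Let B := assoc_mx W a.
Let P := bivector_mx W a.

Let WZ : W *m Z^T = 0.
Proof. by apply: trmx_inj; rewrite trmx_mul trmxK WT mulmxN ZW oppr0 trmx0. Qed.

Let aZ : a^T *m Z^T = 1%:M. Proof. by rewrite -trmx_mul Za trmx1. Qed.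

(** Pairing x B = 0 with the vectors Z gives x a = 0, as Z W = 0 and Z a = 1;
    then x W = 0 as well. *)
Lemma assoc_mx_unit : B \in unitmx.
Proof.
rewrite -row_free_unit -kermx_eq0; apply/rowV0P => x /sub_kermxP xB.
have xa : x *m a = 0.
  have := congr1 (mulmx^~ Z^T) xB.
  by rewrite mul0mx mulmxDr mulmxDl -!mulmxA WZ aZ mulmx1 mulmx0 add0r.
by apply: inj => //; move: xB; rewrite mulmxDr mulmxA xa mul0mx addr0.
Qed.

Lemma invmx_assoc_cov : invmx B *m a = Z^T.
Proof.
have -> : a = B *m Z^T by rewrite mulmxDl -mulmxA WZ aZ mulmx1 add0r.
by rewrite mulKmx ?assoc_mx_unit.
Qed.

Lemma bivector_skew : P^T = - P.
Proof. by rewrite /P linearN /= !trmx_mul trmxK WT mulNmx mulmxN mulmxA. Qed.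

Lemma invmx_assoc_form : invmx B *m W = 1%:M - Z^T *m a^T.
Proof.
have -> : W = B - a *m a^T by rewrite addrK.
by rewrite mulmxBr mulVmx ?assoc_mx_unit // mulmxA invmx_assoc_cov.
Qed.

Lemma bivectorE : P = invmx B *m (1%:M - a *m Z).
Proof.
have <- : - (W *m (invmx B)^T) = 1%:M - a *m Z.
  apply: trmx_inj; rewrite linearN /= trmx_mul trmxK WT mulmxN opprK.
  by rewrite invmx_assoc_form linearB /= trmx1 trmx_mul.
by rewrite /P mulmxN mulmxA.
Qed.

(** The tau_k are Casimir covectors: B^-1 maps them to Z, which omega
    kills. *)
Lemma bivector_cov : P *m a = 0.
Proof.
by rewrite bivectorE -mulmxA mulmxBl mul1mx -mulmxA Za mulmx1 subrr mulmx0.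
Qed.

(** On the right is the transpose of the projection onto H along V, acting on
    covectors. *)
Lemma bivector_form : P *m W = 1%:M - Z^T *m a^T.
Proof.
rewrite bivectorE -mulmxA mulmxBl mul1mx -mulmxA ZW mulmx0 subr0.
exact: invmx_assoc_form.
Qed.

Lemma bivector_form_bivector : P *m W *m P = P.
Proof.
rewrite bivector_form mulmxBl mul1mx -mulmxA.
rewrite (_ : a^T *m P = 0) ?mulmx0 ?subr0 //; apply: trmx_inj.
by rewrite trmx_mul trmxK bivector_skew mulNmx bivector_cov oppr0 trmx0.
Qed.

(** The contractions with omega and with Lambda are inverse to each other
    between H and the covectors that vanish on V. *)
Lemma form_bivector (x : 'rV[R]_m) : x *m a = 0 -> x *m W *m P = x.
Proof.
move=> xa; rewrite -mulmxA (_ : W *m P = 1%:M - a *m Z).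
  by rewrite mulmxBr mulmx1 mulmxA xa mul0mx subr0.
apply: trmx_inj.
rewrite trmx_mul bivector_skew WT mulNmx mulmxN opprK bivector_form.
by rewrite linearB /= trmx1 trmx_mul.
Qed.

End Frame.
End CosymplecticAlgebra.

(** * The Jacobiator in terms of the differentials of the forms *)

Section Jacobi.
Context {R : realType} {m p : nat}.

(** For D x the derivative along x of the matrix of a 2-form, this is the
    exterior derivative evaluated at x, y, z. *)
Definition alt3 (D : 'rV[R]_m -> 'M[R]_m) x y z :=
  bil (D x) y z - bil (D y) x z + bil (D z) x y.

Definition along q (D : 'I_m -> 'M[R]_(m, q)) (x : 'rV[R]_m) : 'M[R]_(m, q) :=
  \sum_l x 0 l *: D l.

Lemma along_linear q (D : 'I_m -> 'M[R]_(m, q)) c x y :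
  along D (c *: x + y) = c *: along D x + along D y.
Proof.
rewrite /along scaler_sumr -big_split /=; apply: eq_bigr => l _.
by rewrite !mxE scalerDl scalerA.
Qed.

Lemma along0 q (D : 'I_m -> 'M[R]_(m, q)) : along D 0 = 0.
Proof. by rewrite /along big1 // => l _; rewrite mxE scale0r. Qed.

Lemma bil_along (D : 'I_m -> 'M[R]_m) x y z :
  bil (along D x) y z = \sum_l x 0 l * bil (D l) y z.
Proof.
rewrite /bil /along mulmx_sumr mulmx_suml summxE.
by apply: eq_bigr => l _; rewrite -scalemxAr -scalemxAl mxE.
Qed.

Lemma bilDr (W : 'M[R]_m) x y z : bil W x (y + z) = bil W x y + bil W x z.
Proof. by rewrite /bil linearD mulmxDr mxE. Qed.

Lemma bil0m x y : bil (0 : 'M[R]_m) x y = 0.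
Proof. by rewrite /bil mulmx0 mul0mx mxE. Qed.

Lemma bilDm (W W' : 'M[R]_m) x y : bil (W + W') x y = bil W x y + bil W' x y.
Proof. by rewrite /bil mulmxDr mulmxDl mxE. Qed.

Variables (P W : 'M[R]_m) (a : 'M[R]_(m, p)) (Z : 'M[R]_(p, m)).
Hypotheses (PT : P^T = - P) (Pa : P *m a = 0) (PWP : P *m W *m P = P).
Hypothesis PW : P *m W = 1%:M - Z^T *m a^T.
Hypothesis horizontalP : forall x : 'rV_m, x *m a = 0 -> x *m W *m P = x.
Hypothesis WT : W^T = - W.
Variables (dP dW : 'I_m -> 'M[R]_m) (da : 'I_m -> 'M[R]_(m, p)).
Hypothesis dPT : forall l, (dP l)^T = - dP l.
Hypothesis dPWP : forall l,
  dP l = dP l *m W *m P + P *m dW l *m P + P *m W *m dP l.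
Hypothesis dPa : forall l, dP l *m a + P *m da l = 0.

(** The cyclic sum of the derivatives of Lambda(y, z) along the vector x P
    that Lambda associates with the covector x; the middle term of [alt3] is
    one of the three by the skewness of dP. *)
Definition jacobiator := alt3 (fun x => along dP (x *m P)).

(** Differentiating P W P = P and evaluating at covectors fixed by P W: the
    terms in which P is differentiated each reproduce the left-hand side, so
    that it equals twice itself minus the right-hand side. *)
Lemma dP_form l y z : y *m P *m W = y -> z *m P *m W = z ->
  bil (dP l) y z = bil (dW l) (y *m P) (z *m P).
Proof.
move=> yPW zPW.
have zT : W *m (P *m z^T) = z^T.
  by rewrite -{2}zPW !trmx_mul PT WT !mulNmx mulmxN opprK.
have Pz : P *m z^T = - (z *m P)^T by rewrite trmx_mul PT mulNmx opprK.
have := congr1 (fun D => bil D y z) (dPWP l); rewrite !bilDm.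
have -> : bil (dP l *m W *m P) y z = bil (dP l) y z.
  by rewrite /bil -!mulmxA zT.
have -> : bil (P *m W *m dP l) y z = bil (dP l) y z.
  by rewrite /bil !mulmxA yPW.
have -> : bil (P *m dW l *m P) y z = - bil (dW l) (y *m P) (z *m P).
  by rewrite /bil -!mulmxA Pz !mulmxN mxE !mulmxA.
lra.
Qed.

Lemma dP_cov l y (c : 'rV_p) :
  bil (dP l) y (c *m a^T) = - (y *m P *m da l *m c^T) 0 0.
Proof.
rewrite /bil trmx_mul trmxK -!mulmxA [dP l *m _]mulmxA.
have -> : dP l *m a = - (P *m da l) by apply/eqP; rewrite -addr_eq0 dPa.
by rewrite mulNmx mulmxN mxE !mulmxA.
Qed.

Lemma jacobiator_form x y z :
  x *m P *m W = x -> y *m P *m W = y -> z *m P *m W = z ->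
  jacobiator x y z = alt3 (along dW) (x *m P) (y *m P) (z *m P).
Proof.
move=> hx hy hz; rewrite /jacobiator /alt3 !bil_along.
by do ?[congr (_ + _) | congr (- _)]; apply: eq_bigr => l _; rewrite dP_form.
Qed.

Let aP : a^T *m P = 0.
Proof. by apply: trmx_inj; rewrite trmx_mul trmxK PT mulNmx Pa oppr0 trmx0. Qed.

(** As tau_k lies in the kernel of P, one of the three terms vanishes, and
    P a = 0 moves the derivatives in the two others from P to a. *)
Lemma jacobiator_cov x y (c : 'rV_p) :
  jacobiator x y (c *m a^T) =
  - ((y *m P *m along da (x *m P) - x *m P *m along da (y *m P)) *m c^T) 0 0.
Proof.
have E u v : bil (along dP (u *m P)) v (c *m a^T) =
    - (v *m P *m along da (u *m P) *m c^T) 0 0.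
  rewrite bil_along mulmx_sumr mulmx_suml summxE -sumrN.
  apply: eq_bigr => l _.
  by rewrite dP_cov -scalemxAr -scalemxAl [in RHS]mxE mulrN.
rewrite /jacobiator /alt3 -[in X in _ + X]mulmxA aP mulmx0 along0.
rewrite bil0m addr0 !E mulmxBl.
by move: (_ *m c^T) (_ *m c^T) => u v; rewrite !mxE; ring.
Qed.

Let alongT x : (along dP x)^T = - along dP x.
Proof.
rewrite /along linear_sum -sumrN; apply: eq_bigr => l _ /=.
by rewrite linearZ /= dPT scalerN.
Qed.

Lemma jacobiator_rot x y z : jacobiator x y z = jacobiator y z x.
Proof.
rewrite /jacobiator /alt3.
rewrite (bil_skew x z) ?alongT // (bil_skew x y) ?alongT //.
ring.
Qed.

Lemma jacobiatorDr x y z t :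
  jacobiator x y (z + t) = jacobiator x y z + jacobiator x y t.
Proof.
rewrite /jacobiator /alt3 mulmxDl -[z *m P]scale1r along_linear !scale1r.
by rewrite !bilDr bilDm; ring.
Qed.

Lemma jacobiator_eq0P :
  (forall x y z, jacobiator x y z = 0) <->
  (forall x y z, x *m a = 0 -> y *m a = 0 -> z *m a = 0 ->
     alt3 (along dW) x y z = 0) /\
  (forall x y, x *m a = 0 -> y *m a = 0 ->
     y *m along da x - x *m along da y = 0).
Proof.
split=> [J0|[dW0 da0]].
  split=> [x y z xa ya za|x y xa ya].
    (* a horizontal x is Lambda-dual to the covector x *m W *)
    rewrite -(horizontalP xa) -(horizontalP ya) -(horizontalP za).
    by rewrite -jacobiator_form ?horizontalP.
  apply/rowP => k; rewrite [RHS]mxE.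
  have := jacobiator_cov (x *m W) (y *m W) (delta_mx 0 k).
  rewrite J0 !horizontalP // trmx_delta -colE mxE => /eqP.
  by rewrite eq_sym oppr_eq0 => /eqP.
(* a combination of the tau_k can be dropped from the last slot, and then,
   rotating the arguments, from each slot *)
have cov0 x y c : jacobiator x y (c *m a^T) = 0.
  by rewrite jacobiator_cov da0 ?mul0mx ?mxE ?oppr0 // -mulmxA Pa mulmx0.
have decomp (x : 'rV_m) : x = x *m P *m W + x *m Z^T *m a^T.
  by rewrite -!mulmxA -mulmxDr PW subrK mulmx1.
have red x y z : jacobiator x y z = jacobiator x y (z *m P *m W).
  by rewrite {1}(decomp z) jacobiatorDr cov0 addr0.
move=> x y z.
rewrite red -jacobiator_rot red -jacobiator_rot red -jacobiator_rot.
have fix_ (u : 'rV_m) : u *m P *m W *m P *m W = u *m P *m W.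
  by rewrite -(mulmxA u) -(mulmxA u (P *m W)) PWP mulmxA.
rewrite jacobiator_form //.
by apply: dW0; rewrite -mulmxA Pa mulmx0.
Qed.

End Jacobi.

(** * Directional derivatives of matrix-valued functions *)

Section MatrixDerivative.
Context {R : realType} {V : normedModType R}.
Implicit Types (u v : V).

Definition mderivable q r (F : V -> 'M[R]_(q, r)) u v :=
  forall i j, derivable (fun x => F x i j) u v.

Definition mderive q r (F : V -> 'M[R]_(q, r)) u v : 'M[R]_(q, r) :=
  \matrix_(i, j) 'D_v (fun x => F x i j) u.

Lemma near_eq_mderive q r (F G : V -> 'M[R]_(q, r)) u v :
  (\forall x \near u, F x = G x) -> mderive F u v = mderive G u v.
Proof.
move=> FG; apply/matrixP => i j; rewrite !mxE; apply: near_eq_derive.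
by near=> x; rewrite (near FG x).
Unshelve. all: by end_near. Qed.

Lemma near_eq_mderivable q r (F G : V -> 'M[R]_(q, r)) u v :
  (\forall x \near u, F x = G x) -> mderivable F u v -> mderivable G u v.
Proof.
move=> FG dF i j; apply: near_eq_derivable (dF i j).
by near=> x; rewrite (near FG x).
Unshelve. all: by end_near. Qed.

Lemma mderivable_cst q r (A : 'M[R]_(q, r)) u v : mderivable (fun=> A) u v.
Proof. by move=> i j; exact: derivable_cst. Qed.

Lemma mderive_cst q r (A : 'M[R]_(q, r)) u v : mderive (fun=> A) u v = 0.
Proof. by apply/matrixP => i j; rewrite !mxE; exact: derive_cst. Qed.

Lemma mulmx_entry q r s (F : V -> 'M[R]_(q, r)) (G : V -> 'M[R]_(r, s)) i j :
  (fun x => (F x *m G x) i j) =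
  \sum_(k < r) ((fun x => F x i k) * (fun x => G x k j)).
Proof. by apply: funext => x; rewrite mxE fct_sumE. Qed.

Lemma mderivable_mulmx q r s (F : V -> 'M[R]_(q, r)) (G : V -> 'M[R]_(r, s))
    u v :
  mderivable F u v -> mderivable G u v ->
  mderivable (fun x => F x *m G x) u v.
Proof.
move=> dF dG i j; rewrite mulmx_entry; apply: derivable_sum => k.
exact: derivableM.
Qed.

Lemma mderive_mulmx q r s (F : V -> 'M[R]_(q, r)) (G : V -> 'M[R]_(r, s)) u v :
  mderivable F u v -> mderivable G u v ->
  mderive (fun x => F x *m G x) u v =
    mderive F u v *m G u + F u *m mderive G u v.
Proof.
move=> dF dG; apply/matrixP => i j.
rewrite mxE mulmx_entry derive_sum => [|k]; last exact: derivableM.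
rewrite !mxE -big_split /=; apply: eq_bigr => k _.
by rewrite deriveM // !mxE addrC /GRing.scale /= [G u k j * _]mulrC.
Qed.

Lemma mderivableD q r (F G : V -> 'M[R]_(q, r)) u v :
  mderivable F u v -> mderivable G u v -> mderivable (fun x => F x + G x) u v.
Proof.
move=> dF dG i j.
rewrite (_ : (fun x => _) = (fun x => F x i j) + (fun x => G x i j)).
  exact: derivableD.
by apply: funext => x; rewrite mxE.
Qed.

Lemma mderivableN q r (F : V -> 'M[R]_(q, r)) u v :
  mderivable F u v -> mderivable (fun x => - F x) u v.
Proof.
move=> dF i j; rewrite (_ : (fun x => _) = - (fun x => F x i j)).
  exact: derivableN.
by apply: funext => x; rewrite mxE.
Qed.

Lemma mderiveN q r (F : V -> 'M[R]_(q, r)) u v :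
  mderivable F u v -> mderive (fun x => - F x) u v = - mderive F u v.
Proof.
move=> dF; apply/matrixP => i j; rewrite !mxE -deriveN //.
by congr ('D_v _ u); apply: funext => x; rewrite mxE.
Qed.

Lemma mderivable_tr q r (F : V -> 'M[R]_(q, r)) u v :
  mderivable F u v -> mderivable (fun x => (F x)^T) u v.
Proof.
move=> dF i j; rewrite (_ : (fun x => _) = (fun x => F x j i)) //.
by apply: funext => x; rewrite mxE.
Qed.

Lemma mderive_tr q r (F : V -> 'M[R]_(q, r)) u v :
  mderive (fun x => (F x)^T) u v = (mderive F u v)^T.
Proof.
apply/matrixP => i j; rewrite !mxE; congr ('D_v _ u).
by apply: funext => x; rewrite mxE.
Qed.

Lemma derivable_prod (I : Type) (s : seq I) (f : I -> V -> R) u v :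
  (forall i, derivable (f i) u v) ->
  derivable (fun x => \prod_(i <- s) f i x) u v.
Proof.
move=> df; elim: s => [|i s IH].
  rewrite (_ : (fun x => _) = cst 1); first exact: derivable_cst.
  by apply: funext => x; rewrite big_nil.
rewrite (_ : (fun x => _) = f i * (fun x => \prod_(j <- s) f j x)).
  exact: derivableM.
by apply: funext => x; rewrite big_cons.
Qed.

Lemma derivable_bigsum (I : Type) (s : seq I) (f : I -> V -> R) u v :
  (forall i, derivable (f i) u v) ->
  derivable (fun x => \sum_(i <- s) f i x) u v.
Proof.
move=> df; elim: s => [|i s IH].
  rewrite (_ : (fun x => _) = cst 0); first exact: derivable_cst.
  by apply: funext => x; rewrite big_nil.
rewrite (_ : (fun x => _) = f i + (fun x => \sum_(j <- s) f j x)).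
  exact: derivableD.
by apply: funext => x; rewrite big_cons.
Qed.

(** The determinant is a polynomial in the entries. *)
Lemma derivable_det q (F : V -> 'M[R]_q) u v :
  mderivable F u v -> derivable (fun x => \det (F x)) u v.
Proof.
move=> dF; apply: derivable_bigsum => s.
have dp := @derivable_prod _ (index_enum _) (fun i x => F x i (s i)) u v
  (fun i => dF i (s i)).
exact: (derivableM (derivable_cst _ _ _) dp).
Qed.

(** By Cramer's rule. Invertibility is required near u because [invmx] is the
    identity on singular matrices. *)
Lemma mderivable_invmx q (F : V -> 'M[R]_q) u v :
  (\forall x \near u, F x \in unitmx) ->
  mderivable F u v -> mderivable (fun x => invmx (F x)) u v.
Proof.
move=> unitF dF.
apply: (@near_eq_mderivable _ _ (fun x => (\det (F x))^-1 *: \adj (F x))).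
  by near=> x; rewrite /invmx (near unitF x).
move=> i j.
rewrite (_ : (fun x => _) = (fun x => (\det (F x))^-1) *
    (cst ((-1) ^+ (j + i)) * (fun x => \det (row' j (col' i (F x))))));
  last first.
  by apply: funext => x; rewrite !mxE.
apply: derivableM.
  apply: derivableV (derivable_det dF).
  by have := nbhs_singleton unitF; rewrite unitmxE unitfE.
apply: derivableM; first exact: derivable_cst.
apply: derivable_det => a b.
rewrite (_ : (fun x => _) = (fun x => F x (lift j a) (lift i b))) //.
by apply: funext => x; rewrite !mxE.
Unshelve. all: by end_near. Qed.

End MatrixDerivative.

(** * The Schouten bracket of a bivector with itself *)

Section LocalExpressions.
Context {R : realType} {m p : nat}.

(** The 1-form now comes last; moving it to the front crosses two arguments,
    which leaves the sign unchanged. *)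
Lemma wedge1r (f : mfun R m 1) (g : mfun R m 2) (A : 'M[R]_(3, m)) :
  skew g ->
  wedge g f A = \sum_(i < 3) (-1) ^+ i * (f (row i A) * g (row' i A)).
Proof.
move=> ag; rewrite /wedge.
rewrite (sum_perm_lift (ord_max : 'I_3) (fun s => tensor g f (row_perm s A))).
rewrite mulr_sumr; apply: eq_bigr => i _.
have ten r : tensor g f (row_perm (lift_perm ord_max i r) A) =
   f (row i A) * g (row_perm r (row' i A)).
  rewrite /tensor mulrC -(row_row_perm_lift ord_max i r).
  rewrite -(row'_row_perm_lift ord_max).
  congr (f _ * g _); apply/matrixP => a b; rewrite !mxE ?(ord1 a).
    by congr (A (lift_perm _ _ _ _) _); apply/val_inj.
  congr (A (lift_perm _ _ _ _) _); apply/val_inj => /=.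
  by case: a => -[|[|]].
under eq_bigr do rewrite ten [_ * (f _ * _)]mulrCA.
rewrite -mulr_sumr -mulr_sumr sum_skew // muln1 exprD sqrrN expr1n mulr1.
rewrite mulrCA; congr (_ * _); rewrite mulrCA mulKf ?factr_neq0 //.
Qed.

Lemma sum_ord3_alt (D : 'rV[R]_m -> 'M[R]_m) (A : 'M[R]_(3, m)) :
  \sum_(i < 3) (-1) ^+ i * bilform (D (row i A)) (row' i A) =
  alt3 D (row 0 A) (row 1 A) (row 2%:R A).
Proof.
rewrite !big_ord_recl big_ord0 /alt3 /bilform !row_row' /=.
rewrite expr0 mul1r addr0 /bump /= addn0 expr1 mulN1r sqrrN expr1n mul1r addrA.
by congr (bil (D (row _ A)) (row _ A) (row _ A) -
  bil (D (row _ A)) (row _ A) (row _ A) +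
  bil (D (row _ A)) (row _ A) (row _ A)); apply/val_inj.
Qed.

Lemma row_pair0 (x y : 'rV[R]_m) : row ord0 (col_mx x y : 'M[R]_(2, m)) = x.
Proof. have -> : (ord0 : 'I_2) = lshift 1 (ord0 : 'I_1) by apply/val_inj.
exact: etrans (rowKu _ _ _) (row_id _ _). Qed.

Lemma row_pair1 (x y : 'rV[R]_m) : row ord_max (col_mx x y : 'M[R]_(2, m)) = y.
Proof. have -> : (ord_max : 'I_2) = rshift 1 (ord0 : 'I_1) by apply/val_inj.
exact: etrans (rowKd _ _ _) (row_id _ _). Qed.

(** The two halves of the bracket agree: contracting L with dx^l on the other
    side changes the sign, and a 1-form commutes with a 2-form. *)
Lemma schoutenE (L : lfield R m 2) u (P : 'M[R]_m) (dP : 'I_m -> 'M[R]_m) A :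
  P^T = - P -> (forall l, (dP l)^T = - dP l) ->
  (forall X, L u X = bilform P X) ->
  (forall l X, partial l L u X = bilform (dP l) X) ->
  @schouten R m 1 1 L L u A =
  2%:R * jacobiator P dP (row 0 A) (row 1 A) (row 2%:R A).
Proof.
move=> PT dPT LP LdP; rewrite /jacobiator -sum_ord3_alt.
pose f l := linform (col l P).
have fE l : (fun X : 'M[R]_(1, m) => L u (col_mx X (std l))) = f l.
  apply: funext => X; rewrite LP /bilform /f /linform.
  rewrite row_pair0 row_pair1.
  by rewrite /bil trmx_delta -mulmxA -colE.
have fE' l :
    (fun X : 'M[R]_(1, m) => L u (col_mx (std l) X)) = (fun X => - f l X).
  apply: funext => X; rewrite LP /bilform /f /linform.
  rewrite row_pair0 row_pair1.
  by rewrite bil_skew // /bil trmx_delta -mulmxA -colE.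
have gE l : partial l L u = bilform (dP l) by apply: funext => X; exact: LdP.
rewrite /schouten.
under eq_bigr => l _.
  rewrite fE fE' gE castmx_id.
  rewrite wedge1l ?wedge1r; try exact: bilform_skew.
  rewrite -sumrB.
  over.
rewrite exchange_big mulr_sumr /=; apply: eq_bigr => i _.
rewrite /bilform bil_along mulr_sumr mulr_sumr; apply: eq_bigr => l _.
rewrite /f /linform -/(bilform _ _) colE mulmxA -colE mxE /bilform.
ring.
Qed.

End LocalExpressions.

(** * Forms as matrices *)

Section FormMatrices.
Context {R : realType} {m : nat}.

Lemma rowlinear_std k (f : mfun R m k) A i : rowlinear f ->
  f A = \sum_j A i j * f (setrow i (std j) A).
Proof.
move=> lf; rewrite -{1}(setrow_row i A) -[row i A]mulmx1 rowlinear_sum //.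
by apply: eq_bigr => j _; rewrite mxE row1.
Qed.

Lemma linform_covector (f : mfun R m 1) :
  multilinear_fun f -> f = linform (covector f).
Proof.
move=> /multilinear_rowlinear lf; apply: funext => A.
rewrite (rowlinear_std _ ord0) // /linform mxE; apply: eq_bigr => j _.
by rewrite setrow1 mxE.
Qed.

Lemma bilform_flat (f : mfun R m 2) :
  multilinear_fun f -> f = bilform (flat f).
Proof.
move=> /multilinear_rowlinear lf; apply: funext => A.
rewrite (rowlinear_std _ ord0) // /bilform bilE; apply: eq_bigr => i _.
rewrite mxE; congr (_ * _).
rewrite (rowlinear_std _ ord_max) // mxE; apply: eq_bigr => j _.
rewrite !mxE /= mulrC; congr (f _ * _).
apply/row_matrixP => -[[|[|//]] b].
  rewrite (_ : Ordinal b = ord0); last exact/val_inj.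
  by rewrite row_pair0 row_setrow_neq // row_setrow.
rewrite (_ : Ordinal b = ord_max); last exact/val_inj.
by rewrite row_pair1 row_setrow.
Qed.

(** Polarisation of omega(x, x) = 0. *)
Lemma flat_skew (f : mfun R m 2) :
  multilinear_fun f -> alternating_fun f -> (flat f)^T = - flat f.
Proof.
move=> lf af; have fE := bilform_flat lf.
have f0 x : bil (flat f) x x = 0.
  have := congr1 (fun g : mfun R m 2 => g (col_mx x x)) fE.
  rewrite /bilform row_pair0 row_pair1 => <-.
  by apply: (af _ ord0 ord_max); rewrite ?row_pair0 ?row_pair1.
apply/matrixP => i j; rewrite !mxE -!/(flat f _ _).
have := f0 (std i + std j).
have bDl x y z : bil (flat f) (x + y) z = bil (flat f) x z + bil (flat f) y z.
  by rewrite /bil !mulmxDl mxE.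
rewrite bDl !bilDr !f0 add0r addr0 !bil_delta !mxE; lra.
Qed.

Variable p : nat.

Definition cov_mx (t : 'I_p -> mfun R m 1) : 'M[R]_(m, p) :=
  \matrix_(i, k) covector (t k) i 0.

Lemma col_cov_mx t k : col k (cov_mx t) = covector (t k).
Proof. by apply/colP => i; rewrite !mxE. Qed.

Lemma flat_assoc_tensor w (t : 'I_p -> mfun R m 1) :
  flat (assoc_tensor w t) = assoc_mx (flat w) (cov_mx t).
Proof.
apply/matrixP => i j; rewrite !mxE /assoc_tensor; congr (_ + _).
apply: eq_bigr => k _; rewrite !mxE /tensor.
by congr (t k _ * t k _); rewrite ?col_mxKu ?col_mxKd.
Qed.

Lemma assoc_bivectorE w (t : 'I_p -> mfun R m 1) : multilinear_fun w ->
  assoc_bivector w t = bilform (bivector_mx (flat w) (cov_mx t)).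
Proof.
move=> lw; apply: funext => A.
rewrite /assoc_bivector flat_assoc_tensor /pullback {1}(bilform_flat lw).
rewrite /bilform /bil /bivector_mx !row_mul trmx_mul mulmxN mulNmx.
by rewrite [in RHS]mxE !mulmxA.
Qed.

Lemma sub_horizontal k (A : 'M[R]_(k, m)) (t : 'I_p -> mfun R m 1) :
  (A <= horizontal t)%MS = (A *m cov_mx t == 0).
Proof.
apply/sub_bigcapmxP/eqP => [sA|A0 j _].
  apply/matrixP => i j; rewrite [RHS]mxE.
  have /sub_kermxP/matrixP/(_ i 0) := sA j isT.
  by rewrite !mxE; apply: etrans; apply: eq_bigr => l _; rewrite !mxE.
apply/sub_kermxP/matrixP => i z; rewrite !ord1.
have := congr1 (fun B : 'M[R]_(k, p) => B i j) A0; rewrite !mxE; apply: etrans.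
by apply: eq_bigr => l _; rewrite !mxE.
Qed.

End FormMatrices.

(** * Differentiating the frame identities *)

Section LocalData.
Context {R : realType} {m p : nat}.

(** What the almost cosymplectic condition is used for at a point: H and V
    meet trivially, and V contains a basis dual to the tau_k. *)
Definition frame_at (W : 'M[R]_m) (a : 'M[R]_(m, p)) :=
  [/\ W^T = - W, forall x : 'rV_m, x *m W = 0 -> x *m a = 0 -> x = 0 &
      exists Z : 'M[R]_(p, m), Z *m W = 0 /\ Z *m a = 1%:M].

(** [jacobiator_eq0P] for actual derivatives: the identities satisfied by P
    hold in a neighbourhood of u, hence their derivatives at u do too. *)
Lemma frame_at_jacobi (W : 'rV[R]_m -> 'M[R]_m) (a : 'rV[R]_m -> 'M[R]_(m, p)) u
    (P := fun x => bivector_mx (W x) (a x))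
    (d := fun q r (F : 'rV[R]_m -> 'M[R]_(q, r)) l => mderive F u (std l)) :
  (\forall x \near u, frame_at (W x) (a x)) ->
  (forall v, mderivable W u v) -> (forall v, mderivable a u v) ->
  [/\ forall v, mderivable P u v, (P u)^T = - P u,
   forall l, (d _ _ P l)^T = - d _ _ P l &
   (forall x y z, jacobiator (P u) (d _ _ P) x y z = 0) <->
   (forall x y z, x *m a u = 0 -> y *m a u = 0 -> z *m a u = 0 ->
     alt3 (along (d _ _ W)) x y z = 0) /\
   (forall x y, x *m a u = 0 -> y *m a u = 0 ->
     y *m along (d _ _ a) x - x *m along (d _ _ a) y = 0)].
Proof.
move=> fr dW da.
have [WT inj [Z [ZW Za]]] := nbhs_singleton fr.
have dB v : mderivable (fun x => invmx (assoc_mx (W x) (a x))) u v.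
  apply: mderivable_invmx.
    near=> x; case: (near fr x) => // ? ? [Y [? ?]].
    exact: (assoc_mx_unit (Z := Y)).
  apply: mderivableD => //; apply: mderivable_mulmx => //.
  exact: mderivable_tr.
have dP v : mderivable P u v.
  apply: mderivableN; apply: mderivable_mulmx; last exact: mderivable_tr.
  exact: mderivable_mulmx.
have dPT l : (d _ _ P l)^T = - d _ _ P l.
  rewrite /d -mderive_tr -mderiveN //; apply: near_eq_mderive.
  by near=> x; case: (near fr x) => // ? ? _; exact: bivector_skew.
have PT : (P u)^T = - P u by exact: bivector_skew.
split=> //; apply: (@jacobiator_eq0P _ _ _ (P u) (W u) (a u) Z).
- exact: PT.
- exact: (bivector_cov WT ZW Za inj).
- exact: (bivector_form_bivector WT ZW Za inj).
- exact: (bivector_form WT ZW Za inj).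
- exact: (form_bivector WT ZW Za inj).
- exact: WT.
- exact: dPT.
- move=> l.
  have : \forall x \near u, P x = P x *m W x *m P x.
    near=> x; case: (near fr x) => // ? ? [Y [? ?]].
    by apply/esym; exact: (bivector_form_bivector (Z := Y)).
  move=> /near_eq_mderive -/(_ (std l)).
  rewrite !mderive_mulmx //; last exact: mderivable_mulmx.
  by rewrite mulmxDl.
- move=> l; rewrite -mderive_mulmx // -[RHS](mderive_cst 0 u (std l)).
  apply: near_eq_mderive.
  near=> x; case: (near fr x) => // ? ? [Y [? ?]].
  exact: (bivector_cov (Z := Y)).
Unshelve. all: by end_near. Qed.

(** Where F is differentiable, directional derivatives are linear in the
    direction, so that partial derivatives determine the exterior
    derivative. *)
Lemma mderive_along q r (F : 'rV[R]_m -> 'M[R]_(q, r)) u v :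
  (forall i j, differentiable (fun x => F x i j) u) ->
  mderive F u v = \sum_l v 0 l *: mderive F u (std l).
Proof.
move=> dF; apply/matrixP => i j.
rewrite summxE !mxE deriveE // {1}[v]row_sum_delta.
rewrite linear_sum; apply: eq_bigr => l _.
by rewrite linearZ /= !mxE deriveE.
Qed.

Lemma derive_bil (W : 'rV[R]_m -> 'M[R]_m) u v y z : mderivable W u v ->
  'D_v (fun x => bil (W x) y z) u = bil (mderive W u v) y z.
Proof.
move=> dW.
have dy : mderivable (fun=> y) u v by exact: mderivable_cst.
have dz : mderivable (fun=> z^T) u v by exact: mderivable_cst.
have := mderive_mulmx (mderivable_mulmx dy dW) dz.
rewrite (mderive_mulmx dy dW) (mderive_cst y u v) (mderive_cst z^T u v).
rewrite mulmx0 addr0 mul0mx add0r.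
by move/matrixP/(_ 0 0); rewrite mxE.
Qed.

End LocalData.

(** * Matrices given by their rows *)

Section Rows.
Context {R : realType} {m : nat}.

Lemma consrow_mul0 k q (x : 'rV[R]_m) (A : 'M[R]_(k, m)) (L : 'M[R]_(m, q)) :
  x *m L = 0 -> A *m L = 0 -> consrow x A *m L = 0.
Proof.
move=> xL AL; apply/row_matrixP => i; rewrite row_mul row0.
case: (unliftP ord0 i) => [j|] ->; last by rewrite row_consrow0.
by rewrite row_consrow_lift -row_mul AL row0.
Qed.

Lemma rows2_consrow (x y : 'rV[R]_m) :
  row 0 (consrow x y) = x /\ row 1 (consrow x y) = y.
Proof.
split; first exact: row_consrow0.
rewrite (_ : 1 = lift ord0 (ord0 : 'I_1)) ?row_consrow_lift ?row_id //.
exact/val_inj.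
Qed.

Lemma rows3_consrow (x y z : 'rV[R]_m) (A := consrow x (consrow y z)) :
  [/\ row 0 A = x, row 1 A = y & row 2%:R A = z].
Proof.
have [y0 z1] := rows2_consrow y z.
split; first exact: row_consrow0.
  rewrite (_ : 1 = lift ord0 (0 : 'I_2)) ?row_consrow_lift //.
  exact/val_inj.
rewrite (_ : 2%:R = lift ord0 (1 : 'I_2)) ?row_consrow_lift //.
exact/val_inj.
Qed.

End Rows.

(** * The statement at a point of a chart *)

Section Chart.
Context {R : realType} {m p : nat} (M : manifold R m).
Variables (w : diff_form M 2) (t : 'I_p -> diff_form M 1).
Variables (c : chart M) (u : 'rV[R]_m).
Hypothesis cu : cod c u.

Let W x := flat (w c x).
Let a x := cov_mx (fun k => t k c x).

Lemma near_cod : \forall x \near u, cod c x.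
Proof. by apply: open_nbhs_nbhs; split; [exact: cod_open | exact: cu]. Qed.

Lemma form_differentiable k (f : diff_form M k) A :
  differentiable (fun x => f c x A) u.
Proof. by have [/(_ u cu)] := form_smooth f c A 1. Qed.

Lemma flat_differentiable i j : differentiable (fun x => W x i j) u.
Proof.
rewrite (_ : (fun x => _) = (fun x => w c x (@col_mx R 1 1 m (std i) (std j)))).
  exact: form_differentiable.
by apply: funext => x; rewrite mxE.
Qed.

Lemma cov_differentiable i k : differentiable (fun x => a x i k) u.
Proof.
rewrite (_ : (fun x => _) = (fun x => t k c x (std i))).
  exact: form_differentiable.
by apply: funext => x; rewrite !mxE.
Qed.

Lemma flat_mderivable v : mderivable W u v.
Proof. by move=> i j; apply: diff_derivable; exact: flat_differentiable. Qed.

Lemma cov_mderivable v : mderivable a u v.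
Proof. by move=> i j; apply: diff_derivable; exact: cov_differentiable. Qed.

Lemma cosymplectic_frame_at n x : almost_cosymplectic n w t ->
  (n * 2 + p)%N = m -> cod c x -> frame_at (W x) (a x).
Proof.
move=> [top next] nm cx.
have WT : (W x)^T = - W x.
  by apply: flat_skew; [exact: form_multilinear|exact: form_alternating].
have wE : w c x = bilform (W x) by apply: bilform_flat; exact: form_multilinear.
have tE : (fun k => t k c x : mfun R m 1) = (fun k => linform (col k (a x))).
  apply: funext => k; rewrite col_cov_mx; apply: linform_covector.
  exact: form_multilinear.
have cWa : cosymplectic_at (W x) (a x) n.
  split=> [|A]; last by rewrite -wE; exact: next.
  by have [A] := top c x cx; rewrite tE wE; exists A.
split=> //; first by move=> y; exact: (cosymplectic_injective WT cWa).
exact: (cosymplectic_dual_frame WT cWa).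
Qed.

Lemma ext_d_form2 A :
  ext_d (w c) u A =
  alt3 (along (fun l => mderive W u (std l))) (row 0 A) (row 1 A) (row 2%:R A).
Proof.
rewrite -sum_ord3_alt; apply: eq_bigr => i _; congr (_ * _).
rewrite /along -mderive_along; last exact: flat_differentiable.
rewrite /bilform -derive_bil; last exact: flat_mderivable.
apply: near_eq_derive; near=> x.
have cx : cod c x by near: x; exact: near_cod.
by rewrite {1}(bilform_flat (form_multilinear w cx)).
Unshelve. all: by end_near. Qed.

Lemma ext_d_form1 k A :
  ext_d (t k c) u A =
  (row 1 A *m along (fun l => mderive a u (std l)) (row 0 A)
   - row 0 A *m along (fun l => mderive a u (std l)) (row 1 A)) 0 k.
Proof.
have E i : 'D_(row i A) (fun x => t k c x (row' i A)) u =
    (row' i A *m along (fun l => mderive a u (std l)) (row i A)) 0 k.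
  rewrite /along -mderive_along; last exact: cov_differentiable.
  have dA : mderivable (fun=> row' i A) u (row i A) by exact: mderivable_cst.
  have := mderive_mulmx dA (@cov_mderivable (row i A)).
  rewrite mderive_cst mul0mx add0r => <-; rewrite [RHS]mxE.
  apply: near_eq_derive; near=> x.
  have cx : cod c x by near: x; exact: near_cod.
  rewrite {1}(linform_covector (form_multilinear (t k) cx)) /linform.
  by rewrite !mxE; apply: eq_bigr => l _; rewrite !mxE.
rewrite /ext_d !big_ord_recl big_ord0 addr0 !E expr0 mul1r /= expr1 mulN1r.
have r0 : row' ord0 A = row 1 A.
  by apply/matrixP => i j; rewrite !mxE !ord1; congr (A _ _); apply/val_inj.
have r1 : row' (lift ord0 ord0) A = row 0 A.
  by apply/matrixP => i j; rewrite !mxE !ord1; congr (A _ _); apply/val_inj.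
rewrite r0 r1 [RHS]mxE [X in _ = _ + X]mxE.
by congr (_ - (_ *m along _ (row _ A)) _ _); apply/val_inj.
Unshelve. all: by end_near. Qed.

Let P x := bivector_mx (W x) (a x).

Lemma cosymplectic_schouten n A : almost_cosymplectic n w t ->
  (n * 2 + p)%N = m ->
  @schouten R m 1 1 (cosymplectic_bivector w t c)
      (cosymplectic_bivector w t c) u A =
  2%:R * jacobiator (P u) (fun l => mderive P u (std l))
           (row 0 A) (row 1 A) (row 2%:R A).
Proof.
move=> ac nm.
have LE x : cod c x ->
    forall X, cosymplectic_bivector w t c x X = bilform (P x) X.
  move=> cx X; rewrite /cosymplectic_bivector assoc_bivectorE //.
  exact: form_multilinear.
have fr : \forall x \near u, frame_at (W x) (a x).
  near=> x; apply: cosymplectic_frame_at ac nm _.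
  by near: x; exact: near_cod.
have [dP PT dPT _] := frame_at_jacobi fr flat_mderivable cov_mderivable.
apply: schoutenE => [//|//||l X]; first exact: LE.
rewrite /partial /bilform -derive_bil; last exact: dP.
apply: near_eq_derive; near=> x; rewrite LE //.
by near: x; exact: near_cod.
Unshelve. all: by end_near. Qed.

(** [proj_mx] is a projection onto H as soon as H and V meet trivially, so
    pulling back by it tests a form exactly on horizontal vectors. *)
Lemma horizontal_proj n k (A : 'M[R]_(k, m)) : almost_cosymplectic n w t ->
  (n * 2 + p)%N = m ->
  let h := pr_horizontal (w c u) (fun i => t i c u) in
  A *m h *m a u = 0 /\ (A *m a u = 0 -> A *m h = A).
Proof.
move=> ac nm h; split.
  by apply/eqP; rewrite -sub_horizontal; exact: proj_mx_sub.
move=> Aa; apply: proj_mx_id; last by rewrite sub_horizontal Aa.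
have [_ inj _] := cosymplectic_frame_at ac nm cu.
apply/eqP/rowV0P => x; rewrite sub_capmx sub_horizontal => /andP[/eqP xa].
by move=> /sub_kermxP xW; exact: inj.
Qed.

(** The rows of A are arbitrary in the bracket and horizontal in the pulled
    back differentials, so both sides are those of [jacobiator_eq0P]. *)
Lemma cosymplectic_poisson_at n : almost_cosymplectic n w t ->
  (n * 2 + p)%N = m ->
  (forall A, @schouten R m 1 1 (cosymplectic_bivector w t c)
     (cosymplectic_bivector w t c) u A = 0) <->
  (forall A, horizontal_d w t w c u A = 0) /\
  (forall k A, horizontal_d w t (t k) c u A = 0).
Proof.
move=> ac nm.
have fr : \forall x \near u, frame_at (W x) (a x).
  near=> x; apply: cosymplectic_frame_at ac nm _.
  by near: x; exact: near_cod.
have [_ _ _ J] := frame_at_jacobi fr flat_mderivable cov_mderivable.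
set h := pr_horizontal (w c u) (fun i => t i c u).
have hA k (A : 'M[R]_(k, m)) i : row i (A *m h) *m a u = 0.
  by rewrite row_mul; exact: (horizontal_proj _ ac nm).1.
have hK k (A : 'M[R]_(k, m)) : A *m a u = 0 -> A *m h = A.
  exact: (horizontal_proj _ ac nm).2.
split=> [S0|[w0 t0] A].
  have /J[w0 t0] x y z :
      jacobiator (P u) (fun l => mderive P u (std l)) x y z = 0.
    have := S0 (consrow x (consrow y z)).
    rewrite (cosymplectic_schouten _ ac nm).
    have [-> -> ->] := rows3_consrow x y z; move/eqP.
    by rewrite mulf_eq0 pnatr_eq0 => /eqP.
  split=> [A|k A]; rewrite /horizontal_d /pullback.
    by rewrite ext_d_form2 w0.
  by rewrite ext_d_form1 t0 // mxE.
rewrite (cosymplectic_schouten _ ac nm).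
rewrite (_ : jacobiator _ _ _ _ _ = 0) ?mulr0 //.
apply: J.2; split=> [x y z xa ya za|x y xa ya].
  have := w0 (consrow x (consrow y z)); rewrite /horizontal_d /pullback hK.
    by rewrite ext_d_form2; have [-> -> ->] := rows3_consrow x y z.
  by do 2?[apply: consrow_mul0 => //].
apply/rowP => k; rewrite [RHS]mxE.
have := t0 k (consrow x y); rewrite /horizontal_d /pullback hK.
  by rewrite ext_d_form1; have [-> ->] := rows2_consrow x y.
exact: consrow_mul0.
Unshelve. all: by end_near. Qed.

End Chart.

Theorem proposition5p9 (R : realType) (n p : nat)
    (M : manifold R (2 * n + p)) (w : diff_form M 2) (t : 'I_p -> diff_form M 1)
    (Hwt : almost_cosymplectic n w t) :
  is_Poisson (cosymplectic_bivector w t) <->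
  (tfield_zero (horizontal_d w t w) /\
   forall k : 'I_p, tfield_zero (horizontal_d w t (t k))).
Proof.
have nm : (n * 2 + p)%N = (2 * n + p)%N by rewrite mulnC.
split=> [L0|[w0 t0] c u cu].
  have H c u (cu : cod c u) :=
    (cosymplectic_poisson_at cu Hwt nm).1 (L0 c u cu).
  by split=> [|k] c u cu; [exact: (H c u cu).1 | exact: (H c u cu).2].
apply: (cosymplectic_poisson_at cu Hwt nm).2; split=> [|k]; first exact: w0.
exact: t0.
Qed.
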